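(* Let $O_n$ be the ortho-chain square cactus of length $n$, let $O_n+e$ be the graph obtained from $O_n$ by attaching a pendant vertex to its end vertex $c_n$, and let $O_n(2)$ be the graph obtained from $O_n$ by attaching a pendant path with two new vertices at $c_n$. For every $n\ge 2$, $$D(O_n,x)=x\,D(O_{n-1},x)+(x^2+2x)\,D(O_{n-1}+e,x)+x^2\,D(O_{n-2}(2),x),$$ with initial condition $D(O_1,x)=x^4+4x^3+6x^2$.
   Context: For a finite simple graph $G=(V,E)$, a set $S\subseteq V$ is dominating if every vertex of $V\setminus S$ is adjacent to at least one vertex of $S$. Let $d(G,i)$ be the number of dominating sets of $G$ of cardinality $i$. The domination polynomial of $G$ is $D(G,x)=\sum_{i=\gamma(G)}^{|V|} d(G,i)x^i$, where $\gamma(G)$ is the minimum cardinality of a dominating set. The ortho-chain $O_n$ is the chain of $n$ squares ($4$-cycles), consecutive squares sharing a cut-vertex, in which the two cut-vertices of each internal square are adjacent. Concretely, $O_n$ has vertices $c_0,\dots,c_n,a_1,\dots,a_n,b_1,\dots,b_n$ and edges $c_{i-1}c_i,\ c_ib_i,\ b_ia_i,\ a_ic_{i-1}$ for $1\le i\le n$; $O_0$ is the single vertex $c_0$. The graph $O_n+e$ is obtained from $O_n$ by adding a new vertex $p$ and the edge $c_np$. The graph $O_n(2)$ is obtained from $O_n$ by adding two new vertices $p,q$ and the edges $c_np$ and $pq$ (so $O_0(2)$ is the path on three vertices). *)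

(* Defs.v *)
From HB Require Import structures.
From mathcomp Require Import all_boot all_order all_algebra.

Set Implicit Arguments.
Unset Strict Implicit.
Unset Printing Implicit Defensive.

Import GRing.Theory.
Local Open Scope ring_scope.

Record sgraph := SGraph {
  svertex :> finType;
  adj : rel svertex;
  adj_sym : symmetric adj;
  adj_irrefl : irreflexive adj
}.

Definition dominating (G : sgraph) (S : {set G}) : bool :=
  [forall v, (v \notin S) ==> [exists u in S, adj v u]].

Definition dom_count (G : sgraph) (i : nat) : nat :=
  #|[set S : {set G} | dominating S & #|S| == i]|.

(* The whole vertex set is always dominating, see [dominatingT]. *)
Definition dom_number (G : sgraph) : nat :=
  #|[arg min_(S < [set: G] | dominating S) #|S|]|.

Lemma dominatingT (G : sgraph) : dominating [set: G].
Proof. by apply/forallP => v; rewrite inE. Qed.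

Definition dom_poly (G : sgraph) : {poly int} :=
  \sum_(dom_number G <= i < #|G|.+1) (dom_count G i)%:R *: 'X^i.

(* [inl i] is c_i, [inr (inl i)] is a_(i+1) and [inr (inr i)] is b_(i+1). *)
Definition ortho_vertex (n : nat) : finType := ('I_n.+1 + ('I_n + 'I_n))%type.

(* Each edge in one orientation: c_i -> c_(i+1), c_(i+1) -> b_(i+1),
   b_(i+1) -> a_(i+1), a_(i+1) -> c_i, for i < n. *)
Definition ortho_arc (n : nat) (u v : ortho_vertex n) : bool :=
  match u, v with
  | inl i, inl j => j == i.+1 :> nat
  | inl i, inr (inr j) => i == j.+1 :> nat
  | inr (inr i), inr (inl j) => i == j
  | inr (inl i), inl j => i == j :> nat
  | _, _ => false
  end.

Definition ortho_adj (n : nat) : rel (ortho_vertex n) :=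
  fun u v => ortho_arc u v || ortho_arc v u.

Lemma ortho_adj_sym (n : nat) : symmetric (@ortho_adj n).
Proof. by move=> u v; rewrite /ortho_adj orbC. Qed.

Lemma ortho_adj_irrefl (n : nat) : irreflexive (@ortho_adj n).
Proof.
by case=> [i|[i|i]]; rewrite /ortho_adj //= orbb; apply: ltn_eqF.
Qed.

Definition ortho_chain (n : nat) : sgraph :=
  SGraph (@ortho_adj_sym n) (@ortho_adj_irrefl n).

Definition ortho_end (n : nat) : ortho_chain n := inl ord_max.

(* [None] is the new vertex. *)
Definition pendant_adj (G : sgraph) (w : G) : rel (option G) :=
  fun u v =>
  match u, v with
  | Some u', Some v' => adj u' v'
  | Some u', None => u' == w
  | None, Some v' => v' == w
  | None, None => false
  end.

Lemma pendant_adj_sym (G : sgraph) (w : G) : symmetric (pendant_adj w).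
Proof. by case=> [u|] [v|] //=; apply: adj_sym. Qed.

Lemma pendant_adj_irrefl (G : sgraph) (w : G) : irreflexive (pendant_adj w).
Proof. by case=> [u|] //=; apply: adj_irrefl. Qed.

Definition pendant (G : sgraph) (w : G) : sgraph :=
  SGraph (pendant_adj_sym w) (pendant_adj_irrefl w).

Definition ortho_chain_e (n : nat) : sgraph := pendant (ortho_end n).

(* [Some None] is p, adjacent to c_n, and [None] is q, adjacent to p. *)
Definition ortho_chain_2 (n : nat) : sgraph :=
  pendant (None : ortho_chain_e n).

(* Main.v *)
Require Import Defs.
From mathcomp Require Import all_boot all_order all_algebra.
From mathcomp Require Import ring zify.

(** Split the vertex subsets of [O_(n-1)] that dominate everything except possibly
    [w = c_(n-1)] by the state of [w], and let [A], [B], [C] be the generating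
    polynomials for: [w] chosen; [w] not chosen but dominated; [w] not dominated.
    Inspecting the eight subsets of the last square gives
    [D(O_n) = (x^3+3x^2+3x) A + (x^3+3x^2+x) B + (x^3+3x^2) C], while
    [D(O_(n-1)) = A + B] and [D(O_(n-1)+e) = x (A+B+C) + A].  The remaining term
    is [x^2 (B+C)]; it counts sets avoiding [w] and not required to dominate it,
    that is, dominating sets of [O_(n-1) - w = O_(n-2)(2)]. *)

Set Implicit Arguments.
Unset Strict Implicit.
Unset Printing Implicit Defensive.

Import GRing.Theory.
Local Open Scope ring_scope.

(** * Domination with exempted vertices *)

Definition covered (G : sgraph) (S : {set G}) (v : G) : bool :=
  (v \in S) || [exists u in S, adj v u].

(** [P] marks the exempted vertices, typically those already dominated by a chosen vertex outside
    the part of the graph under study. *)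
Definition dominates_but (G : sgraph) (P : pred G) (S : {set G}) : bool :=
  [forall v, P v || covered S v].

Lemma eq_dominates_but (G : sgraph) (P Q : pred G) (S : {set G}) :
  P =1 Q -> dominates_but P S = dominates_but Q S.
Proof. by move=> PQ; apply: eq_forallb => v; rewrite PQ. Qed.

Lemma dominatingE (G : sgraph) (S : {set G}) :
  dominating S = dominates_but pred0 S.
Proof. by apply: eq_forallb => v; rewrite implyNb. Qed.

Lemma dominates_but_and (G : sgraph) (w : G) (b : bool) (S : {set G}) :
  dominates_but (fun v => b && (v == w)) S =
  dominates_but (pred1 w) S && (b || covered S w).
Proof.
apply/forallP/andP => [H | [/forallP H bw] v].
  split; last by have := H w; rewrite eqxx andbT.
  apply/forallP => v /=; have := H v.
  by case: (v == w); rewrite ?andbF.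
have /= := H v; case: eqVneq => [->|_] //=; first by rewrite andbT.
by rewrite andbF.
Qed.

(** Grouping the dominating sets by size loses none: minimality of [dom_number] and [max_card] place
    every size in the index range. *)
Lemma dom_poly_sum (G : sgraph) :
  dom_poly G = \sum_(S : {set G} | dominating S) 'X^#|S|.
Proof.
have count i : (dom_count G i)%:R *: 'X^i =
    \sum_(S : {set G} | dominating S && (#|S| == i)) 'X^#|S| :> {poly int}.
  under eq_bigr => S /andP[_ /eqP ->] do over.
  rewrite sumr_const scaler_nat /dom_count; congr (_ *+ _).
  by apply: eq_card => S; rewrite !inE.
have le_dom (S : {set G}) : dominating S -> (dom_number G <= #|S|)%N.
  move=> domS; rewrite /dom_number.
  by case: arg_minnP => [|S0 _]; [apply: dominatingT | apply].
rewrite /dom_poly; under eq_bigr do rewrite count.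
under eq_bigr do rewrite big_mkcondr.
rewrite exchange_big; apply: eq_bigr => S domS /=.
rewrite -big_mkcond /=.
rewrite (eq_bigl (fun i => i == #|S|)); last by move=> i; rewrite eq_sym.
rewrite big_nat1_eq le_dom //= ltnS.
by rewrite max_card.
Qed.

(** * Sums over vertex subsets *)

Lemma sum_set_imset (V : nmodType) (T U : finType) (h : T -> U)
    (F : {set U} -> V) :
  bijective h -> \sum_(S : {set U}) F S = \sum_(S : {set T}) F (h @: S).
Proof.
move=> bij_h; apply: reindex; case: (bij_h) => g hK gK.
exists (fun S : {set U} => g @: S) => S _; rewrite -imset_comp.
  by rewrite (eq_imset _ hK) imset_id.
by rewrite (eq_imset _ gK) imset_id.
Qed.

Definition set_option (T : finType) (b : bool) (S : {set T}) : {set option T} :=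
  [set u | if u is Some v then v \in S else b].

Lemma card_set_option (T : finType) (b : bool) (S : {set T}) :
  #|set_option b S| = (b + #|S|)%N.
Proof.
have -> : set_option b S = if b then None |: Some @: S else Some @: S.
  apply/setP => -[v|]; case: b; rewrite !inE ?mem_imset //=; try exact: Some_inj.
  by apply/esym/imsetP => -[].
by case: b; rewrite ?cardsU1 card_imset //; try exact: Some_inj; case: imsetP => // -[].
Qed.

Lemma sum_set_option (V : nmodType) (T : finType) (F : {set option T} -> V) :
  \sum_(S : {set option T}) F S =
  \sum_(S : {set T}) (F (set_option true S) + F (set_option false S)).
Proof.
transitivity (\sum_(p : bool * {set T}) F (set_option p.1 p.2)).
  apply: reindex; exists (fun S : {set option T} => (None \in S, [set v | Some v \in S])).
    case=> b S _ /=; congr (_, _); first by rewrite inE.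
    by apply/setP => v; rewrite !inE.
  by move=> S _; apply/setP => -[v|]; rewrite !inE.
rewrite -(pair_bigA _ (fun b S => F (set_option b S))) /=.
by rewrite big_bool -big_split.
Qed.

(** * Adding one vertex, then a square *)

(** Generalises [pendant_adj] to any neighbourhood [N]: the vertex closing a square has two
    neighbours. *)
Definition attach_adj (G : sgraph) (N : pred G) : rel (option G) :=
  fun u v =>
  match u, v with
  | Some u', Some v' => adj u' v'
  | Some u', None => N u'
  | None, Some v' => N v'
  | None, None => false
  end.

Lemma attach_adj_sym (G : sgraph) (N : pred G) : symmetric (attach_adj N).
Proof. by case=> [u|] [v|] //=; apply: adj_sym. Qed.

Lemma attach_adj_irrefl (G : sgraph) (N : pred G) : irreflexive (attach_adj N).
Proof. by case=> [u|] //=; apply: adj_irrefl. Qed.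

Definition attach (G : sgraph) (N : pred G) : sgraph :=
  SGraph (attach_adj_sym N) (attach_adj_irrefl N).

Lemma forall_option (T : finType) (P : pred (option T)) :
  [forall u, P u] = P None && [forall v, P (Some v)].
Proof.
apply/forallP/andP => [H|[HN /forallP H] [v|] //].
by split; last apply/forallP.
Qed.

Lemma exists_set_option (T : finType) (b : bool) (S : {set T})
    (P : pred (option T)) :
  [exists u in set_option b S, P u] =
  b && P None || [exists v in S, P (Some v)].
Proof.
apply/existsP/orP => [[[v|]]|[/andP[bT PN]|/existsP[v]]]; rewrite ?inE.
- by right; apply/existsP; exists v.
- by left.
- by exists None; rewrite inE bT.
- by exists (Some v); rewrite inE.
Qed.

Lemma exists_in_pred1 (T : finType) (S : {set T}) (w : T) :
  [exists u in S, u == w] = (w \in S).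
Proof.
apply/existsP/idP => [[u /andP[uS /eqP <-]] //|wS].
by exists w; rewrite wS eqxx.
Qed.

(** The new vertex imposes its own covering condition; if chosen, it exempts its neighbours [N]. *)
Lemma dominates_but_attach (G : sgraph) (N : pred G) (b : bool) (S : {set G})
    (P : pred (attach N)) :
  @dominates_but (attach N) P (set_option b S) =
  [|| P None, b | [exists u in S, N u]] &&
  dominates_but (fun v => P (Some v) || b && N v) S.
Proof.
rewrite /dominates_but forall_option /covered.
congr (_ && _); first by rewrite exists_set_option !inE andbF.
apply: eq_forallb => v; rewrite exists_set_option !inE /= -!orbA.
by congr (_ || _); rewrite orbCA.
Qed.

Lemma dominates_but_pendant (G : sgraph) (w : G) (b : bool) (S : {set G})
    (P : pred (pendant w)) :
  @dominates_but (pendant w) P (set_option b S) =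
  [|| P None, b | w \in S] &&
  dominates_but (fun v => P (Some v) || b && (v == w)) S.
(* The adjacencies of [pendant w] and [attach (pred1 w)] are convertible. *)
Proof. by rewrite -exists_in_pred1; apply: (@dominates_but_attach G (pred1 w)). Qed.

Definition pendant2 (G : sgraph) (w : G) : sgraph := pendant (None : pendant w).

(* A new square [w, a, b, c] at [w]: [a] is [Some (Some None)], [b] is
   [Some None] and [c] is [None]. *)
Definition square (G : sgraph) (w : G) : sgraph :=
  attach [pred u : pendant2 w | (u == Some (Some w)) || (u == None)].

(** The conjuncts cover, in order, the vertices c, b, a, the old vertices other than [w], and
    [w]. *)
Lemma dominates_but_square (G : sgraph) (w : G) (a b c : bool) (S : {set G}) :
  @dominates_but (square w) pred0 (set_option c (set_option b (set_option a S))) =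
  [&& [|| b, c | w \in S], [|| a, b | c], [|| a, b | w \in S],
      dominates_but (pred1 w) S & [|| a, c | covered S w]].
Proof.
rewrite dominates_but_attach !exists_set_option /=.
rewrite !dominates_but_pendant !inE /=.
rewrite (eq_dominates_but (Q := fun v => (a || c) && (v == w))); last first.
  by move=> v; rewrite /= !andbF !orbF -andb_orl orbC.
have -> : [exists v in S, (Some (Some v) == Some (Some w)) ||
    (Some (Some v) == None :> pendant2 w)] = (w \in S).
  by rewrite -exists_in_pred1; apply: eq_existsb => v; rewrite orbF.
rewrite dominates_but_and.
rewrite !andbF !andbT /=.
by case: a; case: b; case: c; case: (w \in S); case: (dominates_but _ S); case: (covered S w).
Qed.

Lemma in_covered (G : sgraph) (S : {set G}) (w : G) : w \in S -> covered S w.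
Proof. by rewrite /covered => ->. Qed.

(** If [w] is chosen, only the empty subset of the three new vertices fails. Otherwise a alone and c
    alone fail too, and b alone fails exactly when [S] leaves [w] uncovered. *)
Lemma dom_poly_square (G : sgraph) (w : G) :
  dom_poly (square w) =
  \sum_(S : {set G} | dominates_but (pred1 w) S)
    'X^#|S| * (if w \in S then 'X^3 + 3%:R * 'X^2 + 3%:R * 'X else
               if covered S w then 'X^3 + 3%:R * 'X^2 + 'X
               else 'X^3 + 3%:R * 'X^2).
Proof.
rewrite dom_poly_sum big_mkcond !sum_set_option [RHS]big_mkcond /=.
apply: eq_bigr => S _.
rewrite !dominatingE !dominates_but_square !card_set_option.
have := @in_covered _ S w; case: (dominates_but _ S) => /=; last first.
  by rewrite !andbF !addr0.
case: (w \in S) => [->|_] //=; last case: (covered S w) => /=;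
  rewrite ?add0n ?add1n ?exprS; ring.
Qed.

(** * Isomorphism invariance and the growth of the chain *)

Lemma covered_iso (G H : sgraph) (h : G -> H) (S : {set G}) (v : G) :
  injective h -> {mono h : u v / adj u v} -> covered (h @: S) (h v) = covered S v.
Proof.
move=> inj_h hadj; rewrite /covered mem_imset //; congr (_ || _).
apply/existsP/existsP => [[_ /andP[/imsetP[u uS ->]]]|[u /andP[uS uv]]].
  by rewrite hadj => uv; exists u; rewrite uS.
by exists (h u); rewrite imset_f //= hadj.
Qed.

Lemma dominates_but_iso (G H : sgraph) (h : G -> H) (P : pred H) (S : {set G}) :
  bijective h -> {mono h : u v / adj u v} ->
  dominates_but P (h @: S) = dominates_but (P \o h) S.
Proof.
move=> bij_h hadj; have inj_h := bij_inj bij_h; case: bij_h => g hK gK.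
apply/forallP/forallP => HP v; first by have := HP (h v); rewrite covered_iso.
by rewrite -(gK v) covered_iso //; apply: HP.
Qed.

Lemma dom_poly_iso (G H : sgraph) (h : G -> H) :
  bijective h -> {mono h : u v / adj u v} -> dom_poly H = dom_poly G.
Proof.
move=> bij_h hadj; rewrite !dom_poly_sum big_mkcond [RHS]big_mkcond /=.
rewrite (sum_set_imset _ bij_h); apply: eq_bigr => S _.
by rewrite !dominatingE dominates_but_iso // card_imset //; apply: bij_inj.
Qed.

(** Old vertices keep their indices, and [None] becomes the new end, so removing that end leaves
    [ortho_chain_2 n]. *)
Definition ortho_step (n : nat) (u : square (ortho_end n)) : ortho_chain n.+1 :=
  match u with
  | Some (Some (Some (inl i))) => inl (widen_ord (leqnSn _) i)
  | Some (Some (Some (inr (inl i)))) => inr (inl (widen_ord (leqnSn _) i))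
  | Some (Some (Some (inr (inr i)))) => inr (inr (widen_ord (leqnSn _) i))
  | Some (Some None) => inr (inl ord_max)
  | Some None => inr (inr ord_max)
  | None => inl ord_max
  end.

Lemma ortho_step_bij (n : nat) : bijective (@ortho_step n).
Proof.
apply: inj_card_bij; last first.
  by rewrite !card_option !card_sum !card_ord; lia.
move=> [[[[i|[i|i]]|]|]|] [[[[j|[j|j]]|]|]|] //= -[] e;
  do ?[congr Some | congr inl | congr inr]; try exact: val_inj;
  by [have := ltn_ord i; lia | have := ltn_ord j; lia].
Qed.

Lemma ortho_step_adj (n : nat) : {mono @ortho_step n : u v / adj u v}.
Proof.
have SomeN (T : eqType) (x : T) : (Some x == None) = false by [].
have inr_end x : (inr x == ortho_end n) = false by [].
move=> [[[[i|[i|i]]|]|]|] [[[[j|[j|j]]|]|]|]; rewrite /= /ortho_adj //=;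
  rewrite ?(inj_eq Some_inj) ?(inj_eq (@inl_inj _ _)) ?SomeN ?inr_end -?val_eqE
    ?eqxx ?orbF //=;
  by do ?[have := ltn_ord i; move: (i : nat) => {}i];
     do ?[have := ltn_ord j; move: (j : nat) => {}j]; lia.
Qed.

Lemma dom_poly_ortho_chainS (n : nat) :
  dom_poly (ortho_chain n.+1) = dom_poly (square (ortho_end n)).
Proof. by apply: (dom_poly_iso (@ortho_step_bij n) (@ortho_step_adj n)). Qed.

(** * The polynomials as sums over sets dominating all but the end *)

Lemma dom_poly_end (G : sgraph) (w : G) :
  dom_poly G = \sum_(S : {set G} | dominates_but (pred1 w) S)
    'X^#|S| * (covered S w)%:R.
Proof.
rewrite dom_poly_sum big_mkcond [RHS]big_mkcond; apply: eq_bigr => S _ /=.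
rewrite dominatingE (dominates_but_and w false).
by case: (dominates_but _ S) => //=; case: (covered S w); rewrite ?mulr0 ?mulr1.
Qed.

(** Choosing the leaf gives the factor ['X] and covers [w]; without it, [w] must be chosen to cover
    the leaf. *)
Lemma dom_poly_pendant (G : sgraph) (w : G) :
  dom_poly (pendant w) = \sum_(S : {set G} | dominates_but (pred1 w) S)
    'X^#|S| * ('X + (w \in S)%:R).
Proof.
rewrite dom_poly_sum big_mkcond sum_set_option [RHS]big_mkcond.
apply: eq_bigr => S _ /=.
rewrite !dominatingE !dominates_but_pendant !card_set_option /=.
rewrite -[dominates_but (eq_op^~ w) S]/(dominates_but (pred1 w) S).
rewrite (dominates_but_and w false).
have := @in_covered _ S w.
case: (dominates_but _ S); rewrite /= ?andbF ?addr0 //.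
case: (w \in S) => [->|_] //=; rewrite add1n exprS; ring.
Qed.

Lemma dom_poly_ortho_chain_2 (n : nat) :
  dom_poly (ortho_chain_2 n) =
  \sum_(S : {set ortho_chain n.+1} | dominates_but (pred1 (ortho_end n.+1)) S)
    'X^#|S| * (ortho_end n.+1 \notin S)%:R.
Proof.
rewrite dom_poly_sum big_mkcond [RHS]big_mkcond /=.
rewrite (sum_set_imset _ (ortho_step_bij n)).
rewrite [RHS](sum_set_option (T := ortho_chain_2 n)).
apply: eq_bigr => S _.
have inj := bij_inj (ortho_step_bij n).
rewrite -[ortho_end n.+1]/(ortho_step None) !mem_imset // !card_imset //.
rewrite !(dominates_but_iso _ _ (ortho_step_bij n) (@ortho_step_adj n)).
(* Sets containing the end contribute 0; the others are subsets of [ortho_chain_2 n]. *)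
rewrite !inE /= mulr0 if_same add0r mulr1 card_set_option dominatingE.
rewrite dominates_but_attach /= eqxx /=.
congr (if _ then _ else _); apply: eq_dominates_but => v.
(* By injectivity no remaining vertex is sent to the exempted end. *)
by rewrite [RHS]orbF; apply/esym/eqP => /(inj (Some v) None).
Qed.

Lemma dom_poly_ortho_chain_1 :
  dom_poly (ortho_chain 1) = 'X^4 + 4%:R *: 'X^3 + 6%:R *: 'X^2.
Proof.
rewrite dom_poly_ortho_chainS dom_poly_square.
have vE (v : ortho_chain 0) : v = ortho_end 0.
  by case: v => [i|[[]|[]]] //; rewrite (ord1 i); congr inl; apply: val_inj.
set w := ortho_end 0.
(* The only vertex is exempt, so both subsets count: [set0] gives x^3+3x^2 and [[set w]] gives
   x(x^3+3x^2+3x). *)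
rewrite (eq_bigl xpredT); last first.
  by move=> S; apply/forallP => v; apply/orP; left; apply/eqP.
rewrite (bigD1 set0) //= (bigD1 [set w]) /=; last first.
  by apply/eqP => /setP /(_ w); rewrite !inE eqxx.
rewrite big1 => [|S /andP[S0 S1]]; last first.
  case/eqP: S1; apply/setP => v; rewrite (vE v) !inE eqxx.
  by have /set0Pn[u] := S0; rewrite (vE u).
rewrite cards0 cards1 !inE eqxx ifF /covered; last first.
  by rewrite inE; apply/existsP => -[u]; rewrite inE.
rewrite -!mul_polyC !rmorph_nat; ring.
Qed.

Theorem theorem8 :
  (forall n : nat, (2 <= n)%N ->
     dom_poly (ortho_chain n) =
       'X * dom_poly (ortho_chain (n - 1))
       + ('X^2 + 2%:R *: 'X) * dom_poly (ortho_chain_e (n - 1))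
       + 'X^2 * dom_poly (ortho_chain_2 (n - 2)))
  /\ dom_poly (ortho_chain 1) = 'X^4 + 4%:R *: 'X^3 + 6%:R *: 'X^2.
Proof.
split; last exact: dom_poly_ortho_chain_1.
case=> [|[|n]] // _; rewrite !subSS !subn0.
rewrite dom_poly_ortho_chainS dom_poly_square dom_poly_ortho_chain_2.
rewrite dom_poly_pendant (dom_poly_end (ortho_end n.+1)).
(* All sums range over the same sets, so the factors of each [S] are compared in the three states of
   the end. *)
rewrite !mulr_sumr -!big_split /=; apply: eq_bigr => S _.
rewrite -mul_polyC rmorph_nat.
move: 'X^#|S| => y.
have := @in_covered (ortho_chain n.+1) S (ortho_end n.+1).
case: (_ \in S) => [->|_] //=; last case: (covered _ _) => /=; ring.
Qed.
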